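(* Let $i:B\to S$ be a ring homomorphism such that the functor $-\otimes_BS:\mathrm{Mod}_B\to\mathrm{Mod}_S$ is comonadic. Then $\Gamma':I^r_B(S)\to\mathrm{End}_{\mathrm{cor}}(S\otimes_BS)$ is an anti-isomorphism of monoids.
   Context: $S$ is a $B$-bimodule via $i$. Sweedler coring $S\otimes_BS$: $S$-bimodule with comultiplication $s\otimes s'\mapsto s\otimes1\otimes s'$, counit $s\otimes s'\mapsto ss'$; $\mathrm{End}_{\mathrm{cor}}(S\otimes_BS)$ is the monoid under composition of $S$-bimodule endomorphisms compatible with comultiplication and counit. A right $S\otimes_BS$-comodule is $(Y,\theta_Y)$ with $Y$ a right $S$-module, $\theta_Y:Y\to Y\otimes_BS$ right $S$-linear, with $(y\otimes s\mapsto ys)\circ\theta_Y=\mathrm{id}$ and $(\theta_Y\otimes_BS)\theta_Y=(\eta'_Y\otimes_BS)\theta_Y$, where $\eta'_Y(y)=y\otimes_B1$. $-\otimes_BS$ is comonadic if the comparison functor $X\mapsto(X\otimes_BS,\eta'_X\otimes_BS)$ from $\mathrm{Mod}_B$ to right $S\otimes_BS$-comodules is an equivalence. $I_B(S)$: monoid of $B$-subbimodules of $S$ with product $IJ=\{\sum_kx_ky_k\}$. $I^r_B(S)$: submonoid of those $I$ with $\mathbf m^r_I:I\otimes_BS\to S$, $x\otimes s\mapsto xs$, an isomorphism. $\Gamma'(I)=(\nu_I\otimes_BS)\circ(S\otimes_B(\mathbf m^r_I)^{-1}):S\otimes_BS\to S\otimes_BI\otimes_BS\to S\otimes_BS$,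 where $\nu_I:S\otimes_BI\to S$ is multiplication. *)

(* Defs.v *)
From HB Require Import structures.
From mathcomp Require Import all_boot all_order all_algebra.
From Stdlib Require Import ClassicalEpsilon.
Set Implicit Arguments. Unset Strict Implicit. Unset Printing Implicit Defensive.
Import GRing.Theory.
Local Open Scope ring_scope.

(* Generic tensor product M (x)_R N of a right R-"module" M and a left *)
(* R-"module" N, built as (free abelian group on M x N) / relations.   *)
(* Modules are given by their raw data (carrier, addition, action);    *)
(* the construction is the standard one and needs no axioms.           *)

Record rdata (R : Type) := RData {
  rcar :> Type; radd : rcar -> rcar -> rcar; ract : rcar -> R -> rcar }.
Record ldata (R : Type) := LData {
  lcar :> Type; ladd : lcar -> lcar -> lcar; lact : R -> lcar -> lcar }.

(* formal Z-linear combinations of pairs *)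
Definition fsum (M N : Type) := seq ((M * N) * int).

Definition coef (M N : Type) (l : fsum M N) (p : M * N) : int :=
  \sum_(q <- l) (if excluded_middle_informative (q.1 = p) then q.2 else 0).

Section TensorDef.
Variables (R : Type) (M : rdata R) (N : ldata R).

Definition tgen (g : fsum M N) : Prop :=
  (exists (m m' : M) (n : N),
     g = [:: ((radd m m', n), 1); ((m, n), -1); ((m', n), -1)]) \/
  (exists (m : M) (n n' : N),
     g = [:: ((m, ladd n n'), 1); ((m, n), -1); ((m, n'), -1)]) \/
  (exists (m : M) (r : R) (n : N),
     g = [:: ((ract m r, n), 1); ((m, lact r n), -1)]).

(* l1 ~ l2 iff l1 - l2 lies in the subgroup generated by the tgen's *)
Definition trel (l1 l2 : fsum M N) : Prop :=
  exists rs : seq (fsum M N * int),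
    List.Forall (fun x => tgen x.1) rs /\
    forall p, coef l1 p - coef l2 p = \sum_(x <- rs) x.2 * coef x.1 p.

Definition tensor : Type := {A : fsum M N -> Prop | exists l, A = trel l}.

Definition tpi (l : fsum M N) : tensor := exist _ (trel l) (ex_intro _ l erefl).

Definition trepr (t : tensor) : fsum M N :=
  proj1_sig (constructive_indefinite_description _ (proj2_sig t)).

Definition tzero : tensor := tpi [::].
Definition tadd (t t' : tensor) : tensor := tpi (trepr t ++ trepr t').

Definition tpure (m : M) (n : N) : tensor := tpi [:: ((m, n), 1)].

(* the additive map M (x) N -> Z induced by a (balanced biadditive) h *)
Definition tlift (Z : zmodType) (h : M -> N -> Z) (t : tensor) : Z :=
  \sum_(q <- trepr t) (h q.1.1 q.1.2) *~ q.2.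
End TensorDef.

Definition tmap (R : Type) (M M' : rdata R) (N N' : ldata R)
  (f : M -> M') (g : N -> N') (t : tensor M N) : tensor M' N' :=
  tpi (map (fun q => ((f q.1.1, g q.1.2), q.2)) (trepr t)).

Section Setting.
Variables (B S : pzRingType) (i : {rmorphism B -> S}).

Definition SBr : rdata B := RData (fun s t : S => s + t) (fun s b => s * i b).
Definition SBl : ldata B := LData (fun s t : S => s + t) (fun b s => i b * s).

(* right B-modules = left B^c-modules; right S-modules = left S^c-modules *)
Definition XBr (X : lmodType B^c) : rdata B :=
  RData (fun x y : X => x + y) (fun x (b : B) => (b : B^c) *: x).
Definition YSr (Y : lmodType S^c) : rdata S :=
  RData (fun x y : Y => x + y) (fun y (s : S) => (s : S^c) *: y).

Definition resB (C : rdata S) : rdata B := RData (@radd _ C) (fun c b => ract c (i b)).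

Definition tsract (M : rdata B) (t : tensor M SBl) (s : S) : tensor M SBl :=
  tmap (M := M) (M' := M) (N := SBl) (N' := SBl) id (fun s' : S => s' * s) t.

Definition TS (C : rdata S) : rdata S :=
  RData (@tadd _ (resB C) SBl) (@tsract (resB C)).

Definition eta' (C : rdata S) (c : C) : TS C := @tpure _ (resB C) SBl c 1.

Definition is_comodule (Y : lmodType S^c) (th : YSr Y -> TS (YSr Y)) : Prop :=
  (forall y y', th (y + y') = tadd (th y) (th y')) /\
  (forall y (s : S), th ((s : S^c) *: y) = tsract (th y) s) /\
  (forall y, @tlift _ (resB (YSr Y)) SBl Y (fun (y : Y) (s : S) => (s : S^c) *: y) (th y) = y) /\
  (forall y, tmap (M := resB (YSr Y)) (M' := resB (TS (YSr Y))) (N := SBl) (N' := SBl) th id (th y)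
             = tmap (M := resB (YSr Y)) (M' := resB (TS (YSr Y))) (N := SBl) (N' := SBl) (@eta' (YSr Y)) id (th y)).

Definition comod_hom (C1 C2 : rdata S) (th1 : C1 -> TS C1) (th2 : C2 -> TS C2)
  (f : C1 -> C2) : Prop :=
  (forall c c', f (radd c c') = radd (f c) (f c')) /\
  (forall c s, f (ract c s) = ract (f c) s) /\
  (forall c, th2 (f c) = tmap (M := resB C1) (M' := resB C2) (N := SBl) (N' := SBl) f id (th1 c)).

Definition rhom (X X' : lmodType B^c) (g : X -> X') : Prop :=
  (forall x y, g (x + y) = g x + g y) /\
  (forall x (b : B), g ((b : B^c) *: x) = (b : B^c) *: g x).

(* the comparison functor K : X |-> (X (x)_B S, eta'_X (x)_B S) *)
Definition KC (X : lmodType B^c) : rdata S :=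
  RData (@tadd _ (XBr X) SBl) (@tsract (XBr X)).
Definition Kth (X : lmodType B^c) (t : KC X) : TS (KC X) :=
  tmap (M := XBr X) (M' := resB (KC X))
       (N := SBl) (N' := SBl) (fun x => @tpure _ (XBr X) SBl x 1) id t.
Definition Kmap (X X' : lmodType B^c) (g : X -> X') : KC X -> KC X' :=
  tmap (M := XBr X) (M' := XBr X') (N := SBl) (N' := SBl) g id.

(* - (x)_B S is comonadic: K is an equivalence of categories, i.e. fully
   faithful and essentially surjective *)
Definition comonadic : Prop :=
  (forall (X X' : lmodType B^c),
     (forall g1 g2 : X -> X', rhom g1 -> rhom g2 ->
        Kmap g1 = Kmap g2 -> g1 = g2) /\
     (forall f : KC X -> KC X', comod_hom (@Kth X) (@Kth X') f ->
        exists g : X -> X', rhom g /\ f = Kmap g)) /\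
  (forall (Y : lmodType S^c) (th : YSr Y -> TS (YSr Y)), is_comodule th ->
     exists (X : lmodType B^c) (f : YSr Y -> KC X),
       comod_hom (C1 := YSr Y) (C2 := KC X) th (@Kth X) f /\ bijective f).

Definition Ct := tensor SBr SBl.
Definition Cpure (s s' : S) : Ct := @tpure _ SBr SBl s s'.
Definition Clact (s : S) (t : Ct) : Ct := tmap (M := SBr) (M' := SBr) (N := SBl) (N' := SBl) (fun a : S => s * a) id t.
Definition Cr : rdata S := RData (@tadd _ SBr SBl) (@tsract SBr).
Definition Cl : ldata S := LData (@tadd _ SBr SBl) Clact.

Definition Delta (t : Ct) : tensor Cr Cl :=
  @tpi _ Cr Cl (map (fun q => ((Cpure q.1.1 1, Cpure 1 q.1.2), q.2)) (trepr t)).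
Definition Ceps (t : Ct) : S := @tlift _ SBr SBl S (fun a b : S => a * b) t.

Definition is_cor_endo (f : Ct -> Ct) : Prop :=
  (forall t t', f (tadd t t') = tadd (f t) (f t')) /\
  (forall s t, f (Clact s t) = Clact s (f t)) /\
  (forall t s, f (tsract t s) = tsract (f t) s) /\
  (forall t, Delta (f t) = tmap (M := Cr) (M' := Cr) (N := Cl) (N' := Cl) f f (Delta t)) /\
  (forall t, Ceps (f t) = Ceps t).

Definition subbimod (I : S -> Prop) : Prop :=
  I 0 /\ (forall x y, I x -> I y -> I (x - y)) /\
  (forall b x, I x -> I (i b * x)) /\ (forall b x, I x -> I (x * i b)).

Definition prodI (I J : S -> Prop) : S -> Prop := fun s =>
  exists l : seq (S * S),
    List.Forall (fun p => I p.1 /\ J p.2) l /\ s = \sum_(p <- l) p.1 * p.2.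

Definition unitI : S -> Prop := fun s => exists b, s = i b.

(* I as a right B-module (operations meaningful when I is a subbimodule) *)
Definition Iadd (I : S -> Prop) (x y : {s | I s}) : {s | I s} :=
  match excluded_middle_informative (I (proj1_sig x + proj1_sig y)) with
  | left h => exist _ _ h | right _ => x end.
Definition Iract (I : S -> Prop) (x : {s | I s}) (b : B) : {s | I s} :=
  match excluded_middle_informative (I (proj1_sig x * i b)) with
  | left h => exist _ _ h | right _ => x end.
Definition Ir (I : S -> Prop) : rdata B := RData (@Iadd I) (@Iract I).

Definition mr (I : S -> Prop) (t : tensor (Ir I) SBl) : S :=
  @tlift _ (Ir I) SBl S (fun (x : Ir I) (s : S) => proj1_sig x * s) t.

Definition in_Ir (I : S -> Prop) : Prop := subbimod I /\ bijective (@mr I).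

(* (m^r_I)^-1 (the inverse when in_Ir I) *)
Definition mrinv (I : S -> Prop) (s : S) : tensor (Ir I) SBl :=
  epsilon (inhabits (@tzero _ (Ir I) SBl)) (fun t => mr t = s).

(* Gamma'(I) = (nu_I (x)_B S) o (S (x)_B (m^r_I)^-1), computed on
   representatives: s (x) s' |-> sum_k s x_k (x) y_k
   where (m^r_I)^-1 (s') = sum_k x_k (x) y_k. *)
Definition Gamma' (I : S -> Prop) (t : Ct) : Ct :=
  @tpi _ SBr SBl (flatten (map (fun q : (S * S) * int =>
         map (fun r : (Ir I * S) * int =>
                (((q.1.1 * proj1_sig r.1.1 : S), (r.1.2 : S)), (q.2 * r.2)%R))
             (trepr (mrinv I q.1.2)))
       (trepr t))).

End Setting.

Arguments is_cor_endo {B S} i f.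
Arguments comonadic {B S} i.
Arguments in_Ir {B S} i I.
Arguments Gamma' {B S} i I t.
Arguments unitI {B S} i _.

(* Main.v *)
Require Import Defs.
From HB Require Import structures.
From mathcomp Require Import all_boot all_order all_algebra.
From mathcomp.classical Require boolp.
From Stdlib Require Import ClassicalEpsilon.
Import GRing.Theory.
Set Implicit Arguments. Unset Strict Implicit. Unset Printing Implicit Defensive.
Local Open Scope ring_scope.

(* If [I (x)_B S -> S] is bijective, then [S] is additively spanned by the
   products [x s'] with [x] in [I], and [Gamma'(I)] is the additive map with
   [s (x) x s' |-> s x (x) s'].  This formula gives compatibility with the
   coring structure, the unit and products.

   Comonadicity enters through one consequence of fullness: an element [t] of
   [X (x)_B S] with [Kth t = t (x) 1] is of the form [x (x) 1].  Applied to
   [X = I] it shows that [I = {s | Gamma'(I)(1 (x) s) = s (x) 1}], hence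
   injectivity.  Given a coring endomorphism [f], the map
   [theta s = f (1 (x) s)] makes [S] a comodule, so [S] is isomorphic to some
   [K X]; the coinvariants [I = {s | theta s = s (x) 1}] then correspond to
   the elements [x (x) 1], so [I (x)_B S -> S] is bijective, and
   [Gamma'(I) = f]. *)

(** * Tensor products as abelian groups *)

Section FormalSums.
Context {M N : Type}.
Implicit Types l : fsum M N.

Definition fscale (c : int) l : fsum M N := [seq (q.1, q.2 * c) | q <- l].

(** Turns the informative decision inside [coef] into a boolean filter, so that the lemmas on
    filtered sums apply. *)
Lemma coefE l p : coef l p = \sum_(q <- l | boolp.asbool (q.1 = p)) q.2.
Proof.
rewrite /coef [RHS]big_mkcond; apply: eq_bigr => q _.
by case: excluded_middle_informative; case: boolp.asboolP.
Qed.

Lemma coef_nil p : coef ([::] : fsum M N) p = 0.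
Proof. by rewrite /coef big_nil. Qed.

Lemma coef_cat l1 l2 p : coef (l1 ++ l2) p = coef l1 p + coef l2 p.
Proof. by rewrite /coef big_cat. Qed.

Lemma coef_scale c l p : coef (fscale c l) p = coef l p * c.
Proof.
rewrite !coefE big_map mulr_suml; exact: eq_bigr.
Qed.

Lemma coef1 (q : M * N) a b p :
  coef [:: (q, a + b)] p = coef [:: (q, a)] p + coef [:: (q, b)] p.
Proof.
rewrite /coef !big_seq1 /=.
by case: excluded_middle_informative => // _; rewrite addr0.
Qed.

Section Eval.
Variables (Z : zmodType) (h : M -> N -> Z).

Definition feval l : Z := \sum_(q <- l) h q.1.1 q.1.2 *~ q.2.

Lemma feval_cat l1 l2 : feval (l1 ++ l2) = feval l1 + feval l2.
Proof. by rewrite /feval big_cat. Qed.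

Lemma feval_scale c l : feval (fscale c l) = feval l *~ c.
Proof.
rewrite /feval big_map mulrz_suml; apply: eq_bigr => q _ /=.
by rewrite mulrzA.
Qed.

(** A list may repeat a pair. All terms over the first pair [q0.1] are split off at once: together
    they contribute a multiple of the coefficient of that pair, which is zero, and the remaining
    list is shorter, still with zero coefficients. *)
Lemma feval_coef0 l : (forall p, coef l p = 0) -> feval l = 0.
Proof.
move: {2}(size l) (leqnn (size l)) => n; elim: n l => [|n IHn] l.
  by case: l => // _ _; rewrite /feval big_nil.
case El: l => [|q0 l'] lel l0; first by rewrite /feval big_nil.
rewrite -El in lel l0 *.
pose P (q : (M * N) * int) : bool := boolp.asbool (q.1 = q0.1).
rewrite /feval (bigID P) /=.
have -> : \sum_(q <- l | P q) h q.1.1 q.1.2 *~ q.2 = 0.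
  rewrite (eq_bigr (fun q : (M * N) * int => h q0.1.1 q0.1.2 *~ q.2)); last first.
    by move=> q /boolp.asboolP ->.
  by rewrite -mulrz_sumr -coefE l0 mulr0z.
rewrite add0r -big_filter; apply: IHn => [|p].
  rewrite -ltnS (leq_trans _ lel) // El /= /P boolp.asboolT //= ltnS.
  by rewrite size_filter count_size.
rewrite coefE big_filter_cond.
have [->|neq] := boolp.pselect (p = q0.1).
  by rewrite big1 // => q /andP[/negP].
rewrite -[RHS](l0 p) coefE; apply: eq_bigl => q.
case: boolp.asboolP; last by rewrite andbF.
by move=> e; rewrite andbT /P; apply/negP => /boolp.asboolP e'; case: neq; rewrite -e.
Qed.

End Eval.
End FormalSums.

(** * The group structure and the universal property of the tensor product *)

Section TensorZmod.
Variables (R : Type) (M : rdata R) (N : ldata R).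
Implicit Types (l : fsum M N) (t : tensor M N).

Lemma trel_coef l1 l2 : coef l1 =1 coef l2 -> trel l1 l2.
Proof.
by move=> e; exists [::]; split=> // p; rewrite e subrr big_nil.
Qed.

Lemma trel_sym l1 l2 : trel l1 l2 -> trel l2 l1.
Proof.
move=> [rs [grs e]]; exists [seq (x.1, - x.2) | x <- rs]; split.
  by elim: grs {e} => //= x s gx _ IHs; constructor.
move=> p; rewrite -opprB e big_map -sumrN.
by apply: eq_bigr => x _; rewrite mulNr.
Qed.

Lemma trel_add l1 l2 l3 l4 :
  trel l1 l2 -> trel l3 l4 -> trel (l1 ++ l3) (l2 ++ l4).
Proof.
move=> [rs [grs e]] [rs' [grs' e']]; exists (rs ++ rs'); split.
  exact/List.Forall_app.
by move=> p; rewrite !coef_cat opprD addrACA e e' big_cat.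
Qed.

Lemma trel_trans l2 l1 l3 : trel l1 l2 -> trel l2 l3 -> trel l1 l3.
Proof.
move=> [rs [grs e]] [rs' [grs' e']]; exists (rs ++ rs'); split.
  exact/List.Forall_app.
by move=> p; rewrite big_cat /= -e -e' addrA subrK.
Qed.

(** A tensor is the predicate [trel l] itself, so equality of classes follows by extensionality from
    symmetry and transitivity of [trel]. *)
Lemma tpi_eq l1 l2 : trel l1 l2 -> tpi l1 = tpi l2.
Proof.
move=> r12; apply/boolp.eq_exist; apply: boolp.funext => l.
by apply: boolp.propext; split; apply: trel_trans => //; apply: trel_sym.
Qed.

Lemma treprK t : tpi (trepr t) = t.
Proof.
rewrite /trepr; case: constructive_indefinite_description => l /= e.
by case: t e => A HA /= e; apply/boolp.eq_exist.
Qed.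

Lemma tpi_rel l1 l2 : tpi l1 = tpi l2 -> trel l1 l2.
Proof. by move=> /(congr1 (@proj1_sig _ _)) /= ->; exact: trel_coef. Qed.

Lemma tadd_tpi l1 l2 : tadd (tpi l1) (tpi l2) = tpi (l1 ++ l2).
Proof. by apply: tpi_eq; apply: trel_add; apply: tpi_rel; rewrite treprK. Qed.

Definition topp t : tensor M N := tpi (fscale (-1) (trepr t)).

Lemma taddA : associative (@tadd _ M N).
Proof.
move=> t u v; rewrite -(treprK t) -(treprK u) -(treprK v) !tadd_tpi.
by rewrite catA.
Qed.

Lemma taddC : commutative (@tadd _ M N).
Proof.
move=> t u; apply: tpi_eq; apply: trel_coef => p.
by rewrite !coef_cat addrC.
Qed.

Lemma tadd0 : left_id (@tzero _ M N) (@tadd _ M N).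
Proof. by move=> t; rewrite -(treprK t) tadd_tpi. Qed.

Lemma taddN : left_inverse (@tzero _ M N) topp (@tadd _ M N).
Proof.
move=> t; rewrite -{2}(treprK t) tadd_tpi; apply: tpi_eq.
apply: trel_coef => p.
by rewrite coef_cat coef_scale coef_nil mulrN1 addNr.
Qed.

HB.instance Definition _ := boolp.gen_eqMixin (tensor M N).
HB.instance Definition _ := boolp.gen_choiceMixin (tensor M N).
HB.instance Definition _ := GRing.isZmodule.Build (tensor M N)
  taddA taddC tadd0 taddN.

Lemma tpi_cat l1 l2 : tpi (l1 ++ l2) = tpi l1 + tpi l2 :> tensor M N.
Proof. by rewrite -tadd_tpi. Qed.

(** By [coef1] the class is additive in [c], hence an integer multiple of its value at [1]. *)
Lemma tpi1 (q : M * N) c : tpi [:: (q, c)] = tpure q.1 q.2 *~ c :> tensor M N.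
Proof.
have addE a b : tpi [:: (q, a + b)] = tpi [:: (q, a)] + tpi [:: (q, b)] :> tensor M N.
  by rewrite -tpi_cat; apply: tpi_eq; apply: trel_coef => p; rewrite coef_cat -coef1.
have E0 : tpi [:: (q, 0)] = 0 :> tensor M N.
  by apply: (addrI (tpi [:: (q, 0)])); rewrite -addE !addr0.
have En n : tpi [:: (q, n%:Z)] = tpure q.1 q.2 *~ n%:Z :> tensor M N.
  elim: n => [|n IHn]; first by rewrite E0.
  by rewrite intS addE mulrzDr IHn mulr1z; case: (q).
case: c => n; first exact: En.
rewrite NegzE mulrNz -En; apply: (addrI (tpi [:: (q, n.+1%:Z)])).
by rewrite -addE !subrr E0.
Qed.

Lemma tpiE l : tpi l = \sum_(q <- l) tpure q.1.1 q.1.2 *~ q.2 :> tensor M N.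
Proof.
elim: l => [|[q c] l IHl]; first by rewrite big_nil.
by rewrite big_cons -IHl -cat1s tpi_cat tpi1.
Qed.

Lemma tpure_eq (g : fsum M N) : tgen g -> tpi g = 0.
Proof.
move=> tg; apply: tpi_eq; exists [:: (g, 1)]; split; first by constructor.
by move=> p; rewrite coef_nil subr0 big_seq1 mul1r.
Qed.

Lemma tpureDl (m m' : M) (n : N) :
  tpure (radd m m') n = tpure m n + tpure m' n :> tensor M N.
Proof.
have /tpure_eq : tgen [:: ((radd m m', n), 1); ((m, n), -1); ((m', n), -1)].
  by left; exists m, m', n.
rewrite tpiE !big_cons big_nil /= !mulrNz !mulr1z addr0 -opprD.
by move/eqP; rewrite subr_eq0 => /eqP.
Qed.

Lemma tpureDr (m : M) (n n' : N) :
  tpure m (ladd n n') = tpure m n + tpure m n' :> tensor M N.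
Proof.
have /tpure_eq : tgen [:: ((m, ladd n n'), 1); ((m, n), -1); ((m, n'), -1)].
  by right; left; exists m, n, n'.
rewrite tpiE !big_cons big_nil /= !mulrNz !mulr1z addr0 -opprD.
by move/eqP; rewrite subr_eq0 => /eqP.
Qed.

Lemma tpure_act (m : M) (r : R) (n : N) :
  tpure (ract m r) n = tpure m (lact r n) :> tensor M N.
Proof.
have /tpure_eq : tgen [:: ((ract m r, n), 1); ((m, lact r n), -1)].
  by right; right; exists m, r, n.
rewrite tpiE !big_cons big_nil /= !mulrNz !mulr1z addr0.
by move/eqP; rewrite subr_eq0 => /eqP.
Qed.

(** Closure under differences together with [P 0] yields opposites and sums, hence all integer
    combinations of pure tensors. *)
Lemma tensor_ind (P : tensor M N -> Prop) :
  (forall t t', P t -> P t' -> P (t - t')) -> (forall m n, P (tpure m n)) ->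
  P 0 -> forall t, P t.
Proof.
move=> PB Pp P0 t.
have PN u : P u -> P (- u) by move=> ?; rewrite -sub0r; exact: PB.
have PD u v : P u -> P v -> P (u + v).
  by move=> Pu /PN Pv; rewrite -[v]opprK; exact: PB.
rewrite -(treprK t) tpiE; elim: (trepr t) => [|q l IHl]; first by rewrite big_nil.
rewrite big_cons; apply/PD => //.
have Pn n : P (tpure q.1.1 q.1.2 *~ n%:Z).
  elim: n => [|n IHn]; first exact: P0.
  by rewrite intS mulrzDr mulr1z; apply: PD.
by case: q.2 => n //; rewrite NegzE mulrNz; apply: PN.
Qed.

Lemma additiveB (V W : zmodType) (f : V -> W) :
  {morph f : x y / x + y} -> {morph f : x y / x - y}.
Proof.
move=> fD x y; apply: (addIr (f y)).
by rewrite -fD !subrK.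
Qed.

Lemma tensor_ext (Z : zmodType) (f g : tensor M N -> Z) :
  {morph f : x y / x + y} -> {morph g : x y / x + y} ->
  (forall m n, f (tpure m n) = g (tpure m n)) -> f =1 g.
Proof.
move=> fD gD fg; elim/tensor_ind => //.
  by move=> t t'; rewrite !additiveB // => -> ->.
by rewrite -(subrr 0) !additiveB // !subrr.
Qed.

(** [tlift] evaluates an arbitrary [h] at a chosen representative; these conditions make the value
    independent of the choice. *)
Definition balanced (Z : zmodType) (h : M -> N -> Z) : Prop :=
  [/\ forall m m' n, h (radd m m') n = h m n + h m' n,
      forall m n n', h m (ladd n n') = h m n + h m n' &
      forall m r n, h (ract m r) n = h m (lact r n)].

Section Lift.
Variables (Z : zmodType) (h : M -> N -> Z).
Hypothesis hbal : balanced h.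

Lemma feval_tgen g : tgen g -> feval h g = 0.
Proof.
case: hbal => hDl hDr hZ.
by case=> [[m [m' [n ->]]]|[[m [n [n' ->]]]|[m [r [n ->]]]]];
  rewrite /feval !big_cons big_nil /= !mulrNz !mulr1z addr0
    ?hDl ?hDr ?hZ -?opprD subrr.
Qed.

(** The relators witnessing [trel l1 l2] are concatenated, with multiplicities, into one formal sum
    [s] with the coefficients of [l1 - l2]. Evaluation kills [s] relator by relator, and kills
    [l1 - l2 - s] because its coefficients vanish. *)
Lemma feval_trel l1 l2 : trel l1 l2 -> feval h l1 = feval h l2.
Proof.
move=> [rs [grs e]].
pose s := flatten [seq fscale x.2 x.1 | x <- rs].
have cs p : coef s p = \sum_(x <- rs) x.2 * coef x.1 p.
  rewrite /s; elim: rs {grs e s} => [|x rs IH]; first by rewrite big_nil coef_nil.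
  by rewrite big_cons /= coef_cat IH coef_scale mulrC.
have s0 : feval h s = 0.
  rewrite /s; elim: grs {e cs s} => [|x {}rs /feval_tgen gx _ IH].
    by rewrite /feval big_nil.
  by rewrite /= feval_cat IH feval_scale gx mul0rz addr0.
have /(@feval_coef0 _ _ _ h) : forall p, coef (l1 ++ fscale (-1) (l2 ++ s)) p = 0.
  move=> p; rewrite coef_cat coef_scale coef_cat cs -e mulrN1.
  by rewrite (addrC (coef l2 p)) subrK subrr.
rewrite feval_cat feval_scale feval_cat s0 addr0 mulrNz mulr1z.
by move/eqP; rewrite subr_eq0 => /eqP.
Qed.

Lemma tlift_tpi l : tlift h (tpi l) = feval h l.
Proof. by apply: feval_trel; apply: tpi_rel; rewrite treprK. Qed.

Lemma tlift_pure m n : tlift h (tpure m n) = h m n.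
Proof. by rewrite tlift_tpi /feval big_seq1 mulr1z. Qed.

Lemma tliftD : {morph tlift h : t t' / t + t'}.
Proof.
move=> t t'; rewrite -(treprK t) -(treprK t') -tpi_cat !tlift_tpi.
by rewrite feval_cat.
Qed.

End Lift.
End TensorZmod.

(** * Functoriality of the tensor product *)

Section TensorMap.
Variables (R : Type) (M M' : rdata R) (N N' : ldata R).

Definition rmor (f : M -> M') : Prop :=
  (forall m m', f (radd m m') = radd (f m) (f m')) /\
  (forall m r, f (ract m r) = ract (f m) r).
Definition lmor (g : N -> N') : Prop :=
  (forall n n', g (ladd n n') = ladd (g n) (g n')) /\
  (forall r n, g (lact r n) = lact r (g n)).

Variables (f : M -> M') (g : N -> N').

Lemma tmapE (t : tensor M N) :
  tmap f g t = tlift (fun m n => tpure (f m) (g n)) t.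
Proof. by rewrite /tmap tpiE big_map. Qed.

Hypotheses (fm : rmor f) (gm : lmor g).

Lemma tmap_balanced : balanced (fun m n => tpure (f m) (g n)).
Proof.
case: fm gm => fD fZ [gD gZ].
split=> *; first by rewrite fD tpureDl.
  by rewrite gD tpureDr.
by rewrite fZ gZ tpure_act.
Qed.

Lemma tmap_pure m n : tmap f g (tpure m n) = tpure (f m) (g n).
Proof. by rewrite tmapE (tlift_pure tmap_balanced). Qed.

Lemma tmapD : {morph tmap f g : t t' / t + t'}.
Proof. by move=> t t'; rewrite !tmapE (tliftD tmap_balanced). Qed.

(** [tmap] is defined through a chosen representative; for linear maps any representative [l] gives
    the same result. *)
Lemma tmap_tpi l :
  tmap f g (tpi l) = tpi [seq ((f q.1.1, g q.1.2), q.2) | q <- l].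
Proof.
by rewrite tmapE (tlift_tpi tmap_balanced) tpiE /feval big_map.
Qed.

End TensorMap.

Lemma rmor_id (R : Type) (M : rdata R) : rmor (M := M) (M' := M) id.
Proof. by []. Qed.
Lemma lmor_id (R : Type) (N : ldata R) : lmor (N := N) (N' := N) id.
Proof. by []. Qed.

(** * The map Gamma' of an invertible subbimodule *)

Section Sweedler.
Variables (B S : pzRingType) (i : {rmorphism B -> S}).

(** * The right action of [S] on [M (x)_B S] *)

Section RightAction.
Variable M : rdata B.
Implicit Types t : tensor M (SBl i).

Lemma lmor_mulr (s : S) : lmor (N := SBl i) (N' := SBl i) (fun s' : S => s' * s).
Proof. by split=> *; rewrite /= ?mulrDl ?mulrA. Qed.

Lemma tsract_pure (m : M) (s' s : S) :
  tsract (tpure (N := SBl i) m s') s = tpure (N := SBl i) m (s' * s).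
Proof. exact: (tmap_pure (rmor_id M) (lmor_mulr s)). Qed.

Lemma tsractD s : {morph (fun t => tsract t s) : t t' / t + t'}.
Proof. exact: (tmapD (rmor_id M) (lmor_mulr s)). Qed.

Lemma tsractA t s s' : tsract (tsract t s) s' = tsract t (s * s').
Proof.
move: t; apply: tensor_ext => [x y|x y|m n]; rewrite ?tsractD //.
by rewrite !tsract_pure mulrA.
Qed.

Lemma tsract1 t : tsract t 1 = t.
Proof.
move: t; apply: tensor_ext => [x y|x y|m n]; rewrite ?tsractD //.
by rewrite !tsract_pure mulr1.
Qed.

Lemma tsractDr t s s' : tsract t (s + s') = tsract t s + tsract t s'.
Proof.
move: t; apply: tensor_ext => [x y|x y|m n].
- by rewrite tsractD.
- by rewrite !tsractD addrACA.
- by rewrite !tsract_pure mulrDr tpureDr.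
Qed.

End RightAction.

(** * Left action, counit and comultiplication of the Sweedler coring *)

Section LeftAction.
Implicit Types t : Ct i.

Lemma rmor_mull (s : S) : rmor (M := SBr i) (M' := SBr i) (fun s' : S => s * s').
Proof. by split=> *; rewrite /= ?mulrDr ?mulrA. Qed.

Lemma Clact_pure (s a b : S) : Clact s (Cpure i a b) = Cpure i (s * a) b.
Proof. exact: (tmap_pure (rmor_mull s) (lmor_id (SBl i))). Qed.

Lemma ClactD s : {morph (@Clact B S i s) : t t' / t + t'}.
Proof. exact: (tmapD (rmor_mull s) (lmor_id (SBl i))). Qed.

Lemma ClactA t s s' : Clact s (Clact s' t) = Clact (s * s') t.
Proof.
move: t; apply: tensor_ext => [x y|x y|m n]; rewrite ?ClactD //.
by rewrite !Clact_pure mulrA.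
Qed.

Lemma Clact1 t : Clact 1 t = t.
Proof.
move: t; apply: tensor_ext => [x y|x y|m n]; rewrite ?ClactD //.
by rewrite !Clact_pure mul1r.
Qed.

Lemma ClactDl t s s' : Clact (s + s') t = Clact s t + Clact s' t.
Proof.
move: t; apply: tensor_ext => [x y|x y|m n].
- by rewrite ClactD.
- by rewrite !ClactD addrACA.
- by rewrite !Clact_pure mulrDl -tpureDl.
Qed.

Lemma Ceps_balanced : balanced (M := SBr i) (N := SBl i) (fun a b : S => a * b).
Proof. by split=> *; rewrite /= ?mulrDl ?mulrDr ?mulrA. Qed.

Lemma Ceps_pure (a b : S) : Ceps (Cpure i a b) = a * b.
Proof. exact: (tlift_pure Ceps_balanced). Qed.

Lemma CepsD : {morph (@Ceps B S i) : t t' / t + t'}.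
Proof. exact: (tliftD Ceps_balanced). Qed.

Lemma Delta_balanced : balanced (M := SBr i) (N := SBl i)
  (fun a b : S => tpure (M := Cr i) (N := Cl i) (Cpure i a 1) (Cpure i 1 b)).
Proof.
split=> [a a' b|a b b'|a r b].
- by rewrite -tpureDl; congr tpure; exact: tpureDl.
- by rewrite -tpureDr; congr tpure; exact: tpureDr.
(* Balancing over [B] gives [a i(r) (x) 1 = (a (x) 1) i(r)]; the scalar [i r] then crosses the outer
   tensor sign, which is over [S]. *)
- have -> : Cpure i (ract (a : SBr i) r) 1 = ract (Cpure i a 1 : Cr i) (i r).
    rewrite /= /Cpure tpure_act [RHS](tsract_pure (M := SBr i)) /=.
    by rewrite mulr1 mul1r.
  rewrite tpure_act; congr tpure; rewrite /= /Cpure Clact_pure.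
  by rewrite -tpure_act /= mulr1 mul1r.
Qed.

Lemma Delta_pure (a b : S) :
  Delta (Cpure i a b) = tpure (M := Cr i) (N := Cl i) (Cpure i a 1) (Cpure i 1 b).
Proof. by rewrite /Delta tpiE big_map; apply: (tlift_pure Delta_balanced). Qed.

Lemma DeltaD : {morph (@Delta B S i) : t t' / t + t'}.
Proof.
by move=> t t'; rewrite /Delta !tpiE !big_map; apply: (tliftD Delta_balanced).
Qed.

End LeftAction.

(** * Invertible subbimodules and the formula for [Gamma'] *)

Section Invertible.
Variable I : S -> Prop.

Lemma subbimodD : subbimod i I -> forall x y, I x -> I y -> I (x + y).
Proof.
by case=> I0 [IB _] x y Ix Iy; rewrite -[y]opprK -[- y]sub0r; apply/IB/IB.
Qed.

(** For a subbimodule the sum stays in [I], so the default branch of [Iadd] is never taken. *)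
Lemma Iadd_val (hI : subbimod i I) (x y : {s | I s}) :
  proj1_sig (Iadd x y) = proj1_sig x + proj1_sig y.
Proof.
rewrite /Iadd; case: excluded_middle_informative => // -[].
by apply: (subbimodD hI); apply: proj2_sig.
Qed.

Lemma Iract_val (hI : subbimod i I) (x : {s | I s}) b :
  proj1_sig (Iract i x b) = proj1_sig x * i b.
Proof.
rewrite /Iract; case: excluded_middle_informative => // -[].
case: hI => _ [_ [_ IZr]]; apply: IZr; exact: proj2_sig.
Qed.

Lemma rmor_val : subbimod i I ->
  rmor (M := Ir i I) (M' := SBr i) (fun x => proj1_sig x).
Proof. by move=> hI; split=> *; rewrite /= (Iadd_val, Iract_val). Qed.

Lemma mr_balanced : subbimod i I ->
  balanced (M := Ir i I) (N := SBl i) (fun x (s : S) => proj1_sig x * s).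
Proof.
move=> hI; split=> *; rewrite /= ?Iadd_val ?Iract_val //.
- by rewrite mulrDl.
- by rewrite mulrDr.
- by rewrite mulrA.
Qed.

Lemma mr_pure (hI : subbimod i I) (x : {s | I s}) (s : S) :
  mr (tpure (M := Ir i I) (N := SBl i) x s) = proj1_sig x * s.
Proof. exact: (tlift_pure (mr_balanced hI)). Qed.

Lemma mrD : subbimod i I -> {morph (@mr B S i I) : t t' / t + t'}.
Proof. by move=> hI; apply: (tliftD (mr_balanced hI)). Qed.

Hypothesis hI : in_Ir i I.

(** [mrinv] is chosen by [epsilon]; surjectivity of [mr] guarantees that a preimage is there to be
    chosen. *)
Lemma mrinvK s : mr (mrinv i I s) = s.
Proof.
case: hI => _ [n _ nK]; apply: (epsilon_spec _ (fun t => mr t = s)).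
by exists (n s).
Qed.

Lemma mrK (t : tensor (Ir i I) (SBl i)) : mrinv i I (mr t) = t.
Proof. by case: hI => _ [n nK _]; apply: (can_inj nK); rewrite mrinvK. Qed.

Lemma mrinv_mul x s (Ix : I x) :
  mrinv i I (x * s) = tpure (M := Ir i I) (N := SBl i) (exist _ x Ix) s.
Proof. by rewrite -[RHS]mrK mr_pure //; case: hI. Qed.

(** Pulling both maps back along the surjection [mr] reduces the comparison to pure tensors. *)
Lemma invertible_ext (Z : zmodType) (F G : S -> Z) :
  {morph F : x y / x + y} -> {morph G : x y / x + y} ->
  (forall x s, I x -> F (x * s) = G (x * s)) -> F =1 G.
Proof.
move=> FD GD FG s; rewrite -(mrinvK s).
have [sI _] := hI.
move: (mrinv i I s); apply: tensor_ext => [x y|x y|x r].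
- by rewrite mrD ?FD.
- by rewrite mrD ?GD.
- rewrite (mr_pure sI x r); apply: FG; exact: proj2_sig.
Qed.

(** This is [s |-> Gamma'(I)(1 (x) s)]: the inverse of [mr] followed by the map induced by the
    inclusion of [I] in [S]. *)
Definition lam (s : S) : Ct i :=
  tmap (M := Ir i I) (M' := SBr i) (N := SBl i) (N' := SBl i)
    (fun x => proj1_sig x) id (mrinv i I s).

Lemma lam_mul x s : I x -> lam (x * s) = Cpure i x s.
Proof.
have [sI _] := hI; move=> Ix.
by rewrite /lam mrinv_mul (tmap_pure (rmor_val sI) (lmor_id _)).
Qed.

Lemma mrinvD : {morph mrinv i I : s s' / s + s'}.
Proof.
have [sI _] := hI; move=> s s'.
by rewrite -[RHS]mrK mrD // !mrinvK.
Qed.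

Lemma lamD : {morph lam : s s' / s + s'}.
Proof.
have [sI _] := hI; move=> s s'.
by rewrite /lam mrinvD (tmapD (rmor_val sI) (lmor_id _)).
Qed.

(** Needed for [Gamma'] to respect balancing over [B]; it holds because [i b * x] is again in
    [I]. *)
Lemma lam_left b s : lam (i b * s) = Clact (i b) (lam s).
Proof.
have [[_ [_ [Il _]]] _] := hI.
move: s; apply: invertible_ext => [x y|x y|x s Ix].
- by rewrite mulrDr lamD.
- by rewrite lamD ClactD.
- by rewrite mulrA !lam_mul ?Clact_pure //; apply: Il.
Qed.

Lemma Gamma'_balanced : balanced (M := SBr i) (N := SBl i)
  (fun s s' : S => Clact s (lam s')).
Proof.
split=> [s s' a|s a b|s r a] /=.
- by rewrite ClactDl.
- by rewrite lamD ClactD.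
- by rewrite lam_left ClactA.
Qed.

(** Turns the formula on representatives into an induced map, to which the universal property
    applies. *)
Lemma Gamma'E t :
  Gamma' i I t = tlift (fun (s : SBr i) (s' : SBl i) => Clact s (lam s')) t.
Proof.
have [sI _] := hI.
rewrite /Gamma' tpiE big_flatten big_map; apply: eq_bigr => -[[s s'] n] _ /=.
(* [lam s'] unfolds to the class of an explicit list, so the left action is computed on that
   list. *)
rewrite [Clact s _](tmap_tpi (rmor_mull s) (lmor_id (SBl i))).
rewrite tpiE !big_map mulrz_suml.
by apply: eq_bigr => q _ /=; rewrite mulrC mulrzA.
Qed.

Lemma Gamma'_pure s s' : Gamma' i I (Cpure i s s') = Clact s (lam s').
Proof. by rewrite Gamma'E (tlift_pure Gamma'_balanced). Qed.

Lemma Gamma'D : {morph Gamma' i I : t t' / t + t'}.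
Proof. by move=> t t'; rewrite !Gamma'E (tliftD Gamma'_balanced). Qed.

Lemma Gamma'_mul s x s' : I x ->
  Gamma' i I (Cpure i s (x * s')) = Cpure i (s * x) s'.
Proof. by move=> Ix; rewrite Gamma'_pure lam_mul // /Cpure Clact_pure. Qed.

Lemma Gamma'_ext (Z : zmodType) (F G : Ct i -> Z) :
  {morph F : x y / x + y} -> {morph G : x y / x + y} ->
  (forall s x s', I x -> F (Cpure i s (x * s')) = G (Cpure i s (x * s'))) ->
  F =1 G.
Proof.
move=> FD GD FG; apply: tensor_ext => // s s'.
rewrite -![tpure _ _]/(Cpure i s _); move: s'.
apply: invertible_ext => [x y|x y|x s' Ix].
- by rewrite -FD; congr F; apply: tpureDr.
- by rewrite -GD; congr G; apply: tpureDr.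
- exact: FG.
Qed.

End Invertible.
End Sweedler.

(** * Products of invertible subbimodules *)

Lemma sval_inj (T : Type) (P : T -> Prop) (x y : {a | P a}) :
  proj1_sig x = proj1_sig y -> x = y.
Proof. by case: x y => [a Pa] [b Pb] /= ab; apply/boolp.eq_exist. Qed.

Section AntiMorphism.
Variables (B S : pzRingType) (i : {rmorphism B -> S}).

(** Right linearity of [f] serves the left tensor factor and left linearity the right one, so
    [f (x) f] makes sense over [S]. *)
Lemma cor_tmap_pure (f : Ct i -> Ct i) : is_cor_endo i f ->
  forall c d, tmap (M := Cr i) (M' := Cr i) (N := Cl i) (N' := Cl i) f f (tpure c d)
    = tpure (M := Cr i) (N := Cl i) (f c) (f d).
Proof.
by move=> [fD [fl [fr _]]]; apply: tmap_pure; split.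
Qed.

(** All identities are checked on [s (x) x s'] with [x] in [I], where [Gamma'] only moves [x] to the
    left. *)
Lemma Gamma'_cor_endo I : in_Ir i I -> is_cor_endo i (Gamma' i I).
Proof.
move=> hI.
have fD : {morph Gamma' i I : t t' / t + t'} by apply: Gamma'D.
have fl s t : Gamma' i I (Clact s t) = Clact s (Gamma' i I t).
  move: t; apply: (Gamma'_ext hI) => [x y|x y|a x b Ix].
  - by rewrite ClactD fD.
  - by rewrite fD ClactD.
  - by rewrite Clact_pure !Gamma'_mul // Clact_pure mulrA.
have fr t s : Gamma' i I (tsract t s) = tsract (Gamma' i I t) s.
  move: t; apply: (Gamma'_ext hI) => [x y|x y|a x b Ix].
  - by rewrite tsractD fD.
  - by rewrite fD tsractD.
  - rewrite /Cpure tsract_pure -mulrA -/(Cpure i _ _) !Gamma'_mul //.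
    by rewrite /Cpure tsract_pure.
have fR : rmor (M := Cr i) (M' := Cr i) (Gamma' i I) by split.
have fL : lmor (N := Cl i) (N' := Cl i) (Gamma' i I) by split.
do !split=> //; last first.
  apply: (Gamma'_ext hI) => [x y|x y|a x b Ix].
  - by rewrite fD CepsD.
  - by rewrite CepsD.
  - by rewrite Gamma'_mul // !Ceps_pure mulrA.
apply: (Gamma'_ext hI) => [x y|x y|a x b Ix].
- by rewrite fD DeltaD.
- by rewrite DeltaD (tmapD fR fL).
rewrite Gamma'_mul // !Delta_pure (tmap_pure fR fL).
rewrite (Gamma'_mul hI 1 b Ix) mul1r.
(* The factor [x] crosses the tensor sign over [S], and [f (a (x) 1) x = f (a (x) x) = a x (x) 1]
   for [f = Gamma'(I)]. *)
have -> : Cpure i x b = lact (x : S) (Cpure i 1 b : Cl i).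
  by rewrite /= Clact_pure mulr1.
rewrite -tpure_act /= -fr /Cpure tsract_pure mul1r -/(Cpure i a x).
by rewrite -[x in Cpure i a x]mulr1 Gamma'_mul.
Qed.

(** The inverse of [mr] is [s |-> 1 (x) s], since an element [i b] crosses the tensor sign over
    [B]. *)
Lemma unitI_in_Ir : in_Ir i (unitI i).
Proof.
have U1 : unitI i 1 by exists 1; rewrite rmorph1.
have sU : subbimod i (unitI i).
  split; first by exists 0; rewrite rmorph0.
  split; first by move=> _ _ [b ->] [c ->]; exists (b - c); rewrite rmorphB.
  split; first by move=> b _ [c ->]; exists (b * c); rewrite rmorphM.
  by move=> b _ [c ->]; exists (c * b); rewrite rmorphM.
split=> //.
exists (fun s => tpure (M := Ir i (unitI i)) (N := SBl i) (exist _ 1 U1) s).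
  apply: (tensor_ext (g := id)) => [x y|//|x s].
    by rewrite mrD // -tpureDr.
  rewrite mr_pure //; case: x => r [b eb] /=.
  have -> : r * s = lact b (s : SBl i) by rewrite eb.
  rewrite -tpure_act; congr tpure.
  by apply: sval_inj; rewrite /= Iract_val //= mul1r.
by move=> s; rewrite mr_pure //= mul1r.
Qed.

Lemma Gamma'_unit : Gamma' i (unitI i) = id.
Proof.
apply: boolp.funext; apply: (Gamma'_ext unitI_in_Ir) => [||s x s' Ix] //.
  exact: Gamma'D unitI_in_Ir.
rewrite (Gamma'_mul unitI_in_Ir) //; case: Ix => b ->.
exact: (tpure_act (M := SBr i) (N := SBl i)).
Qed.

Section Product.
Variables I J : S -> Prop.
Hypotheses (hI : in_Ir i I) (hJ : in_Ir i J).

Lemma prodI_mul x y : I x -> J y -> prodI I J (x * y).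
Proof.
move=> Ix Jy; exists [:: (x, y)]; rewrite big_seq1.
by split=> //; constructor.
Qed.

Lemma prodI_subbimod : subbimod i (prodI I J).
Proof.
have [[I0 [IB [Il Ir]]] _] := hI; have [[J0 [JB [Jl Jr]]] _] := hJ.
split; first by exists [::]; rewrite big_nil.
split=> [_ _ [l [Fl ->]] [l' [Fl' ->]]|].
  exists (l ++ [seq (- p.1, p.2) | p <- l']); split.
    apply/List.Forall_app; split=> //.
    elim: Fl' => //= p s [Ip Jp] _ IHs; constructor=> //; split=> //.
    by rewrite -sub0r; apply: IB.
  rewrite big_cat big_map -sumrN; congr (_ + _).
  by apply: eq_bigr => p _; rewrite mulNr.
split=> b _ [l [Fl ->]].
  exists [seq (i b * p.1, p.2) | p <- l]; split.
    by elim: Fl => //= p s [Ip Jp] _ IHs; constructor=> //; split=> //; apply: Il.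
  by rewrite big_map mulr_sumr; apply: eq_bigr => p _; rewrite mulrA.
exists [seq (p.1, p.2 * i b) | p <- l]; split.
  by elim: Fl => //= p s [Ip Jp] _ IHs; constructor=> //; split=> //; apply: Jr.
by rewrite big_map mulr_suml; apply: eq_bigr => p _; rewrite mulrA.
Qed.

Lemma prodI_ind (P : {s | prodI I J s} -> Prop) :
  (forall w w', P w -> P w' -> P (Iadd w w')) ->
  (forall x y (Ix : I x) (Jy : J y), P (exist _ (x * y) (prodI_mul Ix Jy))) ->
  forall w, P w.
Proof.
have sK := prodI_subbimod.
have [[I0 _] _] := hI; have [[J0 _] _] := hJ.
move=> PD Pm [w Kw]; have [l [Fl ew]] := Kw.
elim: Fl w Kw ew => [|[x y] {}l [/= Ix Jy] Fl IHl] w Kw ew.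
  (* The hypotheses have no case for the empty sum, so it is written as the product of [0] and
     [0]. *)
  move: (Pm 0 0 I0 J0); congr P; apply/boolp.eq_exist.
  by rewrite ew big_nil mul0r.
have Ks : prodI I J (\sum_(p <- l) p.1 * p.2) by exists l.
have <- : Iadd (exist _ (x * y) (prodI_mul Ix Jy)) (exist _ _ Ks) = exist _ w Kw.
  by apply: sval_inj; rewrite (Iadd_val sK) /= ew big_cons.
by apply: PD; [exact: Pm | exact: IHl].
Qed.

Let K := prodI I J.
Let T := tensor (Ir i K) (SBl i).

Let mulw (x : {s | I s}) (u : {s | J s}) : {s | K s} :=
  exist _ (proj1_sig x * proj1_sig u) (prodI_mul (proj2_sig x) (proj2_sig u)).

(** The map [u (x) v |-> x u (x) v]. Combined with the inverses of [mr] for [I] and [J], it yields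
    the inverse of [mr] for their product. *)
Let mulT (x : {s | I s}) : tensor (Ir i J) (SBl i) -> T :=
  tmap (M := Ir i J) (M' := Ir i K) (N := SBl i) (N' := SBl i) (mulw x) id.

Let rmor_mulw x : rmor (M := Ir i J) (M' := Ir i K) (mulw x).
Proof.
have [sI _] := hI; have [sJ _] := hJ; have sK := prodI_subbimod.
split=> [u u'|u b]; apply: sval_inj; rewrite /=.
  by rewrite (Iadd_val sJ) (Iadd_val sK) mulrDr.
by rewrite !Iract_val // mulrA.
Qed.

Let mulT_mul x u v (Ju : J u) :
  mulT x (mrinv i J (u * v))
  = tpure (M := Ir i K) (N := SBl i) (mulw x (exist _ u Ju)) v.
Proof.
by rewrite (mrinv_mul hJ _ Ju) /mulT (tmap_pure (rmor_mulw x) (lmor_id _)).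
Qed.

Let mulT_balanced : balanced (M := Ir i I) (N := SBl i)
  (fun x (y : S) => mulT x (mrinv i J y)).
Proof.
have [sI _] := hI; have [sJ _] := hJ; have sK := prodI_subbimod.
have [_ [_ [Jl _]]] := sJ.
have TD x : {morph (fun y => mulT x (mrinv i J y)) : y y' / y + y'}.
  by move=> y y'; rewrite mrinvD // /mulT (tmapD (rmor_mulw x) (lmor_id _)).
split=> [x x'|x y y'|x b] /=; last 1 first.
- apply: (invertible_ext hJ) => [y y'|y y'|u v Ju]; rewrite ?mulrDr ?TD //.
  rewrite mulrA !mulT_mul; first exact: Jl.
  by move=> ?; congr tpure; apply: sval_inj; rewrite /= Iract_val // mulrA.
- apply: (invertible_ext hJ) => [y y'|y y'|u v Ju]; rewrite ?TD //.
    by rewrite addrACA.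
  rewrite !mulT_mul -tpureDl; congr tpure; apply: sval_inj.
  by rewrite /= (Iadd_val sI) (Iadd_val sK) mulrDl.
- exact: TD.
Qed.

(** The inverse [n] sends [x u v] to [x u (x) v]: the inverse for [I] splits off [x], then the
    inverse for [J] splits off [u]. *)
Lemma prodI_in_Ir : in_Ir i K.
Proof.
have [sI _] := hI; have [sJ _] := hJ; have sK := prodI_subbimod.
split=> //.
pose n (s : S) : T := tlift (fun (x : Ir i I) (y : SBl i) => mulT x (mrinv i J y))
  (mrinv i I s).
have nD : {morph n : s s' / s + s'}.
  by move=> s s'; rewrite /n mrinvD // (tliftD mulT_balanced).
have n_mul x u v (Ix : I x) (Ju : J u) :
    n (x * u * v) = tpure (M := Ir i K) (N := SBl i)
      (mulw (exist _ x Ix) (exist _ u Ju)) v.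
  by rewrite -mulrA /n (mrinv_mul hI _ Ix) (tlift_pure mulT_balanced) mulT_mul.
exists n => [|s].
  apply: (tensor_ext (g := id)) => [t t'|//|w s]; first by rewrite mrD // nD.
  rewrite mr_pure //; move: w; apply: prodI_ind => [w w' IHw IHw'|x y Ix Jy].
    by rewrite (Iadd_val sK) mulrDl nD IHw IHw' -tpureDl.
  by rewrite n_mul.
move: s; apply: (invertible_ext hI) => [s s'|//|x y Ix].
  by rewrite nD mrD.
move: y; apply: (invertible_ext hJ) => [s s'|s s'|u v Ju].
- by rewrite mulrDr nD mrD.
- by rewrite mulrDr.
- by rewrite mulrA n_mul mr_pure.
Qed.

(** Both sides send [s (x) x u v] to [s x u (x) v]. The leftmost factor [x] must come off first, so
    [Gamma' i I] acts first and the order is reversed. *)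
Lemma Gamma'_prod : Gamma' i K = Gamma' i J \o Gamma' i I.
Proof.
have hK := prodI_in_Ir.
apply: boolp.funext; apply: (Gamma'_ext hI) => [t t'|t t'|s x y Ix] /=.
- by rewrite Gamma'D.
- by rewrite !Gamma'D.
move: y; apply: (invertible_ext hJ) => [y y'|y y'|u v Ju].
- by rewrite -Gamma'D // mulrDr; congr Gamma'; apply: tpureDr.
- by rewrite -!Gamma'D // mulrDr; congr (Gamma' _ _ (Gamma' _ _ _)); apply: tpureDr.
rewrite (Gamma'_mul hI) // (Gamma'_mul hJ) //.
by rewrite (mulrA x) (Gamma'_mul hK) ?mulrA //; apply: prodI_mul.
Qed.

End Product.
End AntiMorphism.

(** * Comonadicity *)

Section Comonadic.
Variables (B S : pzRingType) (i : {rmorphism B -> S}).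

(** Common form of [KC X], [Cr i] and [TS C], so that linearity of [m |-> m (x) 1] is proved
    once. *)
Definition extS (M : rdata B) : rdata S :=
  RData (@tadd _ M (SBl i)) (@tsract B S i M).

Lemma rmor_unit (M : rdata B) :
  rmor (M := M) (M' := resB i (extS M)) (fun m => tpure (N := SBl i) m 1).
Proof.
split=> [m m'|m b]; first exact: tpureDl.
by rewrite /= tsract_pure tpure_act /= mulr1 mul1r.
Qed.

Lemma Kth_pure (X : lmodType B^c) (x : XBr X) (s : S) :
  Kth (tpure (N := SBl i) x s : KC i X)
  = tpure (M := resB i (KC i X)) (N := SBl i) (tpure (N := SBl i) x 1) s.
Proof. exact: (tmap_pure (rmor_unit (XBr X)) (lmor_id _)). Qed.

Lemma KthD (X : lmodType B^c) :
  {morph @Kth B S i X : t t' / t + t' >-> tadd t t'}.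
Proof. exact: (tmapD (rmor_unit (XBr X)) (lmor_id _)). Qed.

Lemma Kth_tsract (X : lmodType B^c) (t : KC i X) (s : S) :
  Kth (tsract t s : KC i X) = tsract (Kth t) s.
Proof.
move: t; apply: (tensor_ext (M := XBr X) (N := SBl i)
    (Z := tensor (resB i (KC i X)) (SBl i))) => [t t'|t t'|x r].
- by rewrite tsractD; apply: KthD.
- by rewrite -[RHS]tsractD; congr tsract; apply: KthD.
- by rewrite tsract_pure !Kth_pure tsract_pure.
Qed.

Lemma Kmap_pure (X X' : lmodType B^c) (g : X -> X') (x : XBr X) (s : S) :
  rhom g -> Kmap g (tpure (N := SBl i) x s : KC i X)
  = tpure (N := SBl i) (g x : XBr X') s.
Proof. by case=> gD gZ; apply: tmap_pure. Qed.

Hypothesis comon : comonadic i.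

(* A coinvariant [t] is the same as a comodule map [b (x) s |-> t b s] from
   [K B] to [K X], which by fullness comes from a module map [B -> X]. *)
Lemma coinvariant_pure (X : lmodType B^c) (t : KC i X) :
  Kth t = eta' i t -> exists x : X, t = tpure (M := XBr X) (N := SBl i) x 1.
Proof.
move=> t_coinv.
pose h (b : XBr (B^c)^o) (s : SBl i) : tensor (XBr X) (SBl i) :=
  tsract t (i b * s).
have hbal : balanced h.
  split=> [b b' s|b s s'|b c s]; rewrite /h /=.
  - by rewrite rmorphD mulrDl tsractDr.
  - by rewrite mulrDr tsractDr.
  - by rewrite rmorphM mulrA.
pose f : KC i (B^c)^o -> KC i X := tlift h.
have fD : {morph tlift h : u u' / u + u'} := tliftD hbal.
have f_pure b s : f (tpure b s) = tsract t (i b * s) := tlift_pure hbal b s.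
have fr u s : f (tsract u s) = tsract (f u) s.
  move: u; apply: (tensor_ext (M := XBr (B^c)^o) (N := SBl i)
    (Z := tensor (XBr X) (SBl i))) => [u u'|u u'|b r].
  - by rewrite tsractD; apply: fD.
  - by rewrite /f fD tsractD.
  - by rewrite tsract_pure !f_pure tsractA mulrA.
have fm : rmor (M := resB i (KC i (B^c)^o)) (M' := resB i (KC i X)) f.
  by split=> [|u b]; [exact: fD | exact: fr].
have fhom : comod_hom (@Kth _ _ i _) (@Kth _ _ i X) f.
  do 2!split=> //; apply: (tensor_ext (M := XBr (B^c)^o) (N := SBl i)
    (Z := tensor (resB i (KC i X)) (SBl i))) => [u u'|u u'|b r].
  - by rewrite -[RHS]KthD; congr Kth; apply: fD.
  - by rewrite -[RHS](tmapD fm (lmor_id _)); congr tmap; apply: KthD.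
  (* Coinvariance gives [Kth (t s) = (t (x) 1) s = t (x) s]; for [s = i b * r] the factor [i b]
     moves back onto [t]. *)
  - rewrite f_pure Kth_tsract t_coinv Kth_pure (tmap_pure fm (lmor_id _)) f_pure.
    rewrite /eta' tsract_pure mul1r mulr1.
    exact: (esym (tpure_act (M := resB i (KC i X)) (N := SBl i) t b r)).
have [_ full] := comon.1 (B^c)^o X.
have [g [grhom fg]] := full f fhom.
(* Evaluation at the unit of [B]: [t = f (1 (x) 1) = g 1 (x) 1]. *)
exists (g 1); rewrite -Kmap_pure // -fg f_pure rmorph1 mulr1 tsract1.
by [].
Qed.
End Comonadic.

(** * A subbimodule as a right [B]-module *)

Section Submodule.
Variables (B S : pzRingType) (i : {rmorphism B -> S}).
Variables (I : S -> Prop) (sI : subbimod i I).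

(* [sI] is recorded so that the module structure can depend on it. *)
Definition rsubmod : Type := let _ := sI in {s | I s}.

Let zeroI : rsubmod := exist _ 0 sI.1.
Let oppI (x : rsubmod) : rsubmod :=
  exist _ (0 - proj1_sig x) (sI.2.1 _ _ sI.1 (proj2_sig x)).
(** The operations are those of [Ir i I], so that [KC] of this module is [I (x)_B S] up to
    conversion. *)
Let addI : rsubmod -> rsubmod -> rsubmod := @Iadd S I.
Let scaleI (b : B^c) (x : rsubmod) : rsubmod := Iract i x (b : B).

Let addIA : associative addI.
Proof. by move=> x y z; apply: sval_inj; rewrite !(Iadd_val sI) addrA. Qed.
Let addIC : commutative addI.
Proof. by move=> x y; apply: sval_inj; rewrite !(Iadd_val sI) addrC. Qed.
Let add0I : left_id zeroI addI.
Proof. by move=> x; apply: sval_inj; rewrite (Iadd_val sI) add0r. Qed.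
Let addNI : left_inverse zeroI oppI addI.
Proof. by move=> x; apply: sval_inj; rewrite (Iadd_val sI) /= sub0r addNr. Qed.

HB.instance Definition _ := boolp.gen_eqMixin rsubmod.
HB.instance Definition _ := boolp.gen_choiceMixin rsubmod.
HB.instance Definition _ := GRing.isZmodule.Build rsubmod addIA addIC add0I addNI.

Let scaleIA a b x : scaleI a (scaleI b x) = scaleI (a * b) x.
Proof. by apply: sval_inj; rewrite !Iract_val // -mulrA -rmorphM. Qed.
Let scale1I : left_id 1 scaleI.
Proof. by move=> x; apply: sval_inj; rewrite Iract_val // rmorph1 mulr1. Qed.
Let scaleIDr : right_distributive scaleI +%R.
Proof.
by move=> a x y; apply: sval_inj; rewrite !(Iract_val, Iadd_val sI) // mulrDl.
Qed.
Let scaleIDl x : {morph scaleI^~ x : a b / a + b}.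
Proof.
by move=> a b; apply: sval_inj; rewrite !(Iract_val, Iadd_val sI) // rmorphD mulrDr.
Qed.

HB.instance Definition _ :=
  GRing.Zmodule_isLmodule.Build B^c rsubmod scaleIA scale1I scaleIDr scaleIDl.

End Submodule.

Section Correspondence.
Variables (B S : pzRingType) (i : {rmorphism B -> S}).
Hypothesis comon : comonadic i.

(** * Recovering [I] from [Gamma'(I)] *)

Section Injectivity.
Variables (I : S -> Prop) (hI : in_Ir i I).

Lemma mrinv_tsract s s' : mrinv i I (s * s') = tsract (mrinv i I s) s'.
Proof.
move: s; apply: (invertible_ext hI) => [x y|x y|x s Ix].
- by rewrite mulrDl mrinvD.
- by rewrite mrinvD // tsractD.
- by rewrite -mulrA !(mrinv_mul hI _ Ix) tsract_pure.
Qed.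

(** Along the isomorphism [mrinv] from [S] to [I (x) S], the map [lam] becomes [Kth] and
    [s |-> s (x) 1] becomes [eta']. The equation thus makes [mrinv i I s] coinvariant, so it is some
    [x (x) 1], and applying [mr] gives [s = x]. *)
Lemma Gamma'_coinvariant s :
  Gamma' i I (Cpure i 1 s) = Cpure i s 1 <-> I s.
Proof.
have [sI _] := hI.
split=> [Gs|Is]; last by rewrite -{1}[s]mulr1 Gamma'_mul // mul1r.
pose X : lmodType B^c := rsubmod sI.
pose P : Ct i -> tensor (resB i (KC i X)) (SBl i) :=
  tmap (M := SBr i) (M' := resB i (KC i X)) (N := SBl i) (N' := SBl i) (mrinv i I) id.
have mrinv_rmor : rmor (M := SBr i) (M' := resB i (KC i X)) (mrinv i I).
  by split=> [a b|a b]; [exact: mrinvD | exact: mrinv_tsract].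
have PD : {morph P : u v / u + v} := tmapD mrinv_rmor (lmor_id _).
have P_pure a b : P (Cpure i a b)
    = tpure (M := resB i (KC i X)) (N := SBl i) (mrinv i I a) b.
  exact: (tmap_pure mrinv_rmor (lmor_id _)).
(* On a product [x u] both sides equal [(x (x) 1) (x) u]. *)
have Plam u : P (lam i I u) = Kth (mrinv i I u : KC i X).
  move: u; apply: (invertible_ext hI (Z := tensor (resB i (KC i X)) (SBl i)))
    => [x y|x y|x u Ix].
  - by rewrite lamD // PD.
  - by rewrite mrinvD //; apply: KthD.
  rewrite lam_mul // P_pure (mrinv_mul hI _ Ix) Kth_pure -{1}[x]mulr1.
  by rewrite (mrinv_mul hI _ Ix).
have /(coinvariant_pure comon)[x ex] :
    Kth (mrinv i I s : KC i X) = eta' i (mrinv i I s : KC i X).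
  by rewrite -Plam -[lam i I s]Clact1 -Gamma'_pure // Gs P_pure.
by rewrite -(mrinvK hI s) ex (mr_pure sI x) mulr1; apply: proj2_sig.
Qed.

End Injectivity.

(** * Realizing a coring endomorphism as some [Gamma'(I)] *)

Section Surjectivity.
Variable f : Ct i -> Ct i.
Hypothesis f_cor : is_cor_endo i f.

Definition coinvariants (s : S) : Prop := f (Cpure i 1 s) = Cpure i s 1.

Let fD : {morph f : t t' / t + t'} := f_cor.1.
Let fl : forall s t, f (Clact s t) = Clact s (f t) := f_cor.2.1.
Let fr : forall t s, f (tsract t s) = tsract (f t) s := f_cor.2.2.1.

(** The coaction on [S] attached to [f]. By left linearity it determines [f], through
    [f (s (x) s') = s theta(s')]. *)
Definition theta (s : S) : Ct i := f (Cpure i 1 s).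

Lemma thetaD : {morph theta : s s' / s + s'}.
Proof. by move=> s s'; rewrite /theta -fD; congr f; apply: tpureDr. Qed.

Lemma theta_mul s s' : theta (s * s') = tsract (theta s) s'.
Proof. by rewrite /theta -fr /Cpure tsract_pure. Qed.

Lemma cor_endo_pure s s' : f (Cpure i s s') = Clact s (theta s').
Proof. by rewrite /theta -fl Clact_pure mulr1. Qed.

Let Y : lmodType S^c := (S^c)^o.

(* The isomorphism [C (x)_S (S (x)_B S) ~ C (x)_B S], with [C = S (x)_B S]. *)
Let omega : tensor (Cr i) (Cl i) -> tensor (resB i (Cr i)) (SBl i) :=
  tlift (fun (c : Cr i) (d : Cl i) =>
    tmap (M := SBr i) (M' := resB i (Cr i)) (N := SBl i) (N' := SBl i)
      (fun s => tsract c s : Cr i) id d).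

Let rmor_tsract (c : Ct i) :
  rmor (M := SBr i) (M' := resB i (Cr i)) (fun s : S => tsract c s : Cr i).
Proof. by split=> [s s'|s b] /=; [exact: tsractDr | rewrite tsractA]. Qed.

Let omega_balanced : balanced (M := Cr i) (N := Cl i)
  (fun c d => tmap (M := SBr i) (M' := resB i (Cr i)) (N := SBl i) (N' := SBl i)
      (fun s => tsract c s : Cr i) id d).
Proof.
split=> [c c' d|c d d'|c s d].
- move: d; apply: (tensor_ext (M := SBr i) (N := SBl i)) => [t t'|t t'|a b].
  + exact: (tmapD (rmor_tsract _) (lmor_id _)).
  + by rewrite !(tmapD (rmor_tsract _) (lmor_id _)) addrACA.
  + rewrite !(tmap_pure (rmor_tsract _) (lmor_id _)) -tpureDl; congr tpure.
    exact: tsractD.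
- exact: (tmapD (rmor_tsract _) (lmor_id _)).
- move: d; apply: (tensor_ext (M := SBr i) (N := SBl i)) => [t t'|t t'|a b].
  + exact: (tmapD (rmor_tsract _) (lmor_id _)).
  + rewrite -(tmapD (rmor_tsract _) (lmor_id _)); congr tmap; exact: ClactD.
  + rewrite /= [Clact _ _]Clact_pure !(tmap_pure (rmor_tsract _) (lmor_id _)).
    by rewrite tsractA.
Qed.

Let omegaD : {morph omega : u v / u + v} := tliftD omega_balanced.

Let omega_pure (c : Ct i) (a b : S) :
  omega (tpure (M := Cr i) (N := Cl i) c (Cpure i a b))
  = tpure (M := resB i (Cr i)) (N := SBl i) (tsract c a) b.
Proof.
rewrite /omega (tlift_pure omega_balanced).
exact: (tmap_pure (rmor_tsract c) (lmor_id _)).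
Qed.

Lemma theta_rmor : rmor (M := SBr i) (M' := resB i (Cr i)) theta.
Proof. by split=> [a b|a b]; [exact: thetaD | exact: theta_mul]. Qed.

(** The counit law is compatibility of [f] with [Ceps] at [1 (x) s]. For coassociativity, [omega] is
    applied to compatibility with [Delta] at [1 (x) s]: one side becomes [(eta' (x) S) theta(s)],
    the other, [theta(1) (x) theta(s)], becomes [(theta (x) S) theta(s)]. *)
Lemma theta_comodule : is_comodule (i := i) (Y := Y) theta.
Proof.
have [_ [_ [_ [fDelta feps]]]] := f_cor.
split; first exact: thetaD.
split; first by move=> s s'; exact: theta_mul.
split.
  by move=> s; have := feps (Cpure i 1 s); rewrite [RHS]Ceps_pure mul1r.
move=> s.
have omegaDelta t : omega (Delta t) = tmap (M := SBr i) (M' := resB i (Cr i))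
    (N := SBl i) (N' := SBl i) (fun s => Cpure i s 1) id t.
  move: t; apply: (tensor_ext (M := SBr i) (N := SBl i)) => [t t'|t t'|a b].
  - by rewrite DeltaD omegaD.
  - exact: (tmapD (rmor_unit i (SBr i)) (lmor_id _)).
  - rewrite [Delta _]Delta_pure omega_pure tsract1.
    by rewrite (tmap_pure (rmor_unit i (SBr i)) (lmor_id _)).
have omega_f t : omega (tpure (M := Cr i) (N := Cl i) (theta 1) t)
    = tmap (M := SBr i) (M' := resB i (Cr i)) (N := SBl i) (N' := SBl i) theta id t.
  move: t; apply: (tensor_ext (M := SBr i) (N := SBl i)) => [t t'|t t'|a b].
  - by rewrite -omegaD; congr omega; apply: tpureDr.
  - exact: (tmapD theta_rmor (lmor_id _)).
  - rewrite [LHS]omega_pure (tmap_pure theta_rmor (lmor_id _)).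
    by rewrite -theta_mul mul1r.
rewrite -[LHS]omega_f -[RHS]omegaDelta fDelta Delta_pure.
by rewrite (cor_tmap_pure f_cor).
Qed.

(** The set is the equalizer of [theta] and [s |-> s (x) 1], both of which are [B]-bilinear because
    [i b] crosses the tensor sign. *)
Lemma coinvariants_subbimod : subbimod i coinvariants.
Proof.
have eD : {morph (fun s => Cpure i s 1) : s s' / s + s'}.
  by move=> s s'; apply: tpureDl.
have cB x y : coinvariants x -> coinvariants y -> coinvariants (x - y).
  rewrite /coinvariants -!/(theta _) => cx cy.
  by rewrite (additiveB thetaD) cx cy -(additiveB eD).
split.
  rewrite /coinvariants -/(theta 0) -(subrr 0) (additiveB thetaD) subrr.
  by rewrite (additiveB eD) subrr.
split=> //; split=> b x cx; rewrite /coinvariants.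
  have -> : Cpure i 1 (i b * x) = Clact (i b) (Cpure i 1 x).
    rewrite Clact_pure mulr1 -[i b in RHS]mul1r.
    exact: (esym (tpure_act (M := SBr i) (N := SBl i) 1 b x)).
  by rewrite fl cx Clact_pure.
rewrite -/(theta _) theta_mul /theta cx /Cpure tsract_pure mul1r -[i b in LHS]mulr1.
exact: (esym (tpure_act (M := SBr i) (N := SBl i) x b 1)).
Qed.

(** Essential surjectivity gives an isomorphism [phi] from [S] to [X (x) S]. Its inverse [psi] sends
    each [x (x) 1] to a coinvariant [w x], and [phi] followed by [w (x) S] is the inverse of
    [mr]. *)
Lemma coinvariants_in_Ir : in_Ir i coinvariants.
Proof.
have sI := coinvariants_subbimod.
split=> //.
have [X [phi [[phiD [phiZ phiTh]] [psi phiK psiK]]]] := comon.2 Y theta theta_comodule.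
have phiM (z s : S) : phi (z * s) = tsract (phi z) s := phiZ z s.
have psiD (u v : KC i X) : psi (tadd u v) = psi u + psi v.
  by apply: (can_inj phiK); rewrite psiK phiD /= !psiK.
have psiZ (u : KC i X) (s : S) : psi (tsract u s) = @GRing.mul S (psi u) s.
  by apply: (can_inj phiK); rewrite psiK phiM psiK.
have phim : rmor (M := SBr i) (M' := resB i (KC i X)) phi.
  by split=> [a b|a b]; [exact: phiD | exact: phiZ].
have psim : rmor (M := resB i (KC i X)) (M' := SBr i) psi.
  by split=> [a b|a b]; [exact: psiD | exact: psiZ].
pose Phi : Ct i -> _ :=
  tmap (M := SBr i) (M' := resB i (KC i X)) (N := SBl i) (N' := SBl i) phi id.
pose Psi : _ -> Ct i :=
  tmap (M := resB i (KC i X)) (M' := SBr i) (N := SBl i) (N' := SBl i) psi id.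
(* Injectivity of [Phi] allows equations in [S (x) S] to be tested after transport along [phi]. *)
have PhiK : cancel Phi Psi.
  apply: (tensor_ext (M := SBr i) (N := SBl i) (g := id)) => [u v|//|a b].
    by rewrite /Phi (tmapD phim (lmor_id _)) /Psi (tmapD psim (lmor_id _)).
  rewrite /Phi (tmap_pure phim (lmor_id _)) /Psi (tmap_pure psim (lmor_id _)).
  by rewrite phiK.
have Phi_pure a : Phi (Cpure i a 1) = eta' i (phi a : KC i X).
  exact: (tmap_pure phim (lmor_id _)).
have coinv_pure z : coinvariants z ->
    exists x : XBr X, phi z = tpure (N := SBl i) x 1.
  move=> cz; apply: (coinvariant_pure comon).
  by rewrite (phiTh z) -Phi_pure -cz.
have pure_coinv (x : XBr X) : coinvariants (psi (tpure (N := SBl i) x 1)).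
  apply: (can_inj PhiK); rewrite Phi_pure psiK -[LHS](phiTh (psi _)) psiK.
  exact: Kth_pure.
pose w (x : XBr X) : Ir i coinvariants := exist _ _ (pure_coinv x).
have wm : rmor (M := XBr X) (M' := Ir i coinvariants) w.
  have [uD uZ] := rmor_unit i (XBr X).
  split=> [x y|x b]; apply: sval_inj.
    by rewrite /= (Iadd_val sI) /= -psiD; congr psi; apply: uD.
  by rewrite /= Iract_val //= -psiZ; congr psi; apply: uZ.
pose W : KC i X -> tensor (Ir i coinvariants) (SBl i) :=
  tmap (M := XBr X) (M' := Ir i coinvariants) (N := SBl i) (N' := SBl i) w id.
have WD : {morph tmap (M := XBr X) (M' := Ir i coinvariants)
      (N := SBl i) (N' := SBl i) w id : u v / u + v} := tmapD wm (lmor_id _).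
have W_pure x s : W (tpure x s) = tpure (w x) s := tmap_pure wm (lmor_id _) x s.
exists (fun s => W (phi s)) => [|s].
  apply: (tensor_ext (g := id)) => [t t'|//|z s].
    by rewrite mrD // -WD; congr W; apply: phiD.
  (* Here [phi z = x (x) 1], so [w x = z] and [z s] is sent to [w x (x) s = z (x) s]. *)
  have [x ex] := coinv_pure _ (proj2_sig z).
  rewrite (mr_pure sI z s) phiM ex.
  rewrite tsract_pure mul1r W_pure; congr tpure; apply: sval_inj.
  by rewrite /= -ex phiK.
rewrite -[RHS]phiK; move: (phi s).
apply: (tensor_ext (M := XBr X) (N := SBl i) (Z := S)) => [u v|u v|x r].
- by rewrite /W WD mrD.
- exact: psiD.
- by rewrite W_pure mr_pure //= -psiZ tsract_pure mul1r.
Qed.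

(** For a coinvariant [x], [f (s (x) x s') = s theta(x) s' = s x (x) s'], which is the formula for
    [Gamma']. *)
Lemma Gamma'_coinvariants : Gamma' i coinvariants = f.
Proof.
have hI := coinvariants_in_Ir.
apply: boolp.funext; apply: (Gamma'_ext hI) => [t t'|//|s x s' cx].
  exact: Gamma'D.
by rewrite Gamma'_mul // cor_endo_pure theta_mul /theta cx /Cpure tsract_pure
  mul1r Clact_pure.
Qed.

End Surjectivity.

End Correspondence.

Theorem theorem3p6 (B S : pzRingType) (i : {rmorphism B -> S}) :
  comonadic i ->
  (forall I, in_Ir i I -> is_cor_endo i (Gamma' i I)) /\
  Gamma' i (unitI i) = id /\
  (forall I J, in_Ir i I -> in_Ir i J ->
     Gamma' i (prodI I J) = Gamma' i J \o Gamma' i I) /\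
  (forall I J, in_Ir i I -> in_Ir i J -> Gamma' i I = Gamma' i J -> I = J) /\
  (forall f, is_cor_endo i f -> exists I, in_Ir i I /\ Gamma' i I = f).
Proof.
move=> comon; split; first exact: Gamma'_cor_endo.
split; first exact: Gamma'_unit.
split; first exact: Gamma'_prod.
split=> [I J hI hJ eIJ|f f_cor].
  apply: boolp.funext => s; apply: boolp.propext.
  (* Membership in [I] is read off from [Gamma' i I], hence agrees with membership in [J]. *)
  rewrite -(Gamma'_coinvariant comon hI) eIJ.
  exact: Gamma'_coinvariant.
exists (coinvariants f).
split; [exact: coinvariants_in_Ir | exact: Gamma'_coinvariants].
Qed.
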